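(* Let $\mathcal{H}=\mathcal{H}(\Omega)$ be a functional (reproducing kernel) Hilbert space on a nonempty set $\Omega$, let $t\in[0,1]$ and let $A,B\in\mathcal{B}(\mathcal{H})$. Then, for the following operator on $\mathcal{H}\oplus\mathcal{H}$, $$\left\|\begin{pmatrix} 0 & A \\ B & 0 \end{pmatrix}\right\|_{t-ber}\le\max\{t,1-t\}\left(\|A\|_{ber}+\|B\|_{ber}\right).$$
   Context: A functional (reproducing kernel) Hilbert space $\mathcal{H}=\mathcal{H}(\Omega)$ is a Hilbert space of complex-valued functions on a nonempty set $\Omega$ such that for every $\lambda\in\Omega$ the evaluation $f\mapsto f(\lambda)$ is a continuous linear functional; $k_\lambda\in\mathcal{H}$ is the unique element with $f(\lambda)=\langle f,k_\lambda\rangle$ for all $f\in\mathcal{H}$. It is assumed that $k_\lambda\neq0$ for all $\lambda\in\Omega$, and $\hat{k}_\lambda=k_\lambda/\|k_\lambda\|$ is the normalized reproducing kernel. $\mathcal{B}(\mathcal{H})$ is the algebra of bounded linear operators on $\mathcal{H}$. For $A\in\mathcal{B}(\mathcal{H})$, $\|A\|_{ber}=\sup_{\lambda,\mu\in\Omega}|\langle A\hat{k}_\lambda,\hat{k}_\mu\rangle|$. For operators on $\mathcal{H}\oplus\mathcal{H}$ the index set is $\Omega\times\Omega$, the kernel at $(\lambda_1,\lambda_2)$ is the vector $(k_{\lambda_1},k_{\lambda_2})\in\mathcal{H}\oplus\mathcal{H}$, and its normalization is $\hat{k}_{(\lambda_1,\lambda_2)}=(k_{\lambda_1},k_{\lambda_2})/\sqrt{\|k_{\lambda_1}\|^2+\|k_{\lambda_2}\|^2}$;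 for $T\in\mathcal{B}(\mathcal{H}\oplus\mathcal{H})$ and $t\in[0,1]$, $$\|T\|_{t-ber}=\sup\left\{t|\langle T\hat{k}_{(\lambda_1,\lambda_2)},\hat{k}_{(\mu_1,\mu_2)}\rangle|+(1-t)|\langle T^*\hat{k}_{(\lambda_1,\lambda_2)},\hat{k}_{(\mu_1,\mu_2)}\rangle|:(\lambda_1,\lambda_2),(\mu_1,\mu_2)\in\Omega\times\Omega\right\}.$$ *)

(* Defs.v *)
From HB Require Import structures.
From mathcomp Require Import all_boot all_order all_algebra sesquilinear.
From mathcomp Require Import complex.
From mathcomp Require Import boolp classical_sets reals topology normedtype.

Set Implicit Arguments.
Unset Strict Implicit.
Unset Printing Implicit Defensive.

Import Order.TTheory GRing.Theory Num.Theory.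
Import numFieldNormedType.Exports.

Local Open Scope classical_set_scope.
Local Open Scope ring_scope.
Local Open Scope complex_scope.

(* The inner product is linear in its first argument and conjugate-linear in
   its second one. *)
HB.mixin Record NormedModule_isHilbert (R : realType) H
    & CompleteNormedModule R[i] H := {
  inner : {dot H for Num.conj};
  innerE : forall x : H, inner x x = `|x| ^+ 2
}.

#[short(type="hilbertType")]
HB.structure Definition Hilbert (R : realType) :=
  {H of NormedModule_isHilbert R H & CompleteNormedModule R[i] H}.

(* A vector [f : H] stands for the function [feval f : Omega -> R[i]]; since
   [feval] is linear and injective, [H] is a linear space of functions. *)
HB.mixin Record Hilbert_isFunctional (R : realType) (Omega : Type) H
    & Hilbert R H := {
  feval : H -> Omega -> R[i];
  feval_inj : injective feval;
  feval_linear : forall (l : Omega) (a : R[i]) (f g : H),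
    feval (a *: f + g) l = a * feval f l + feval g l;
  feval_continuous : forall l : Omega,
    continuous (fun f : H => feval f l : (R[i])^o)
}.

#[short(type="functionalHilbertType")]
HB.structure Definition FunctionalHilbert (R : realType) (Omega : Type) :=
  {H of Hilbert_isFunctional R Omega H & Hilbert R H}.

Section Berezin.
Context {R : realType} {Omega : Type} {H : functionalHilbertType R Omega}.

(* Existence (by the Riesz representation theorem, as evaluations are
   continuous) and uniqueness make the default value 0 irrelevant. *)
Definition kernel (l : Omega) : H :=
  xget 0 [set k : H | forall f : H, feval f l = inner f k].

Definition nkernel (l : Omega) : H := `|kernel l|^-1 *: kernel l.

(* The modulus [`|z|] of [z : R[i]] is again in [R[i]]; [complex.Re] makes it an
   element of [R].  The sets below are nonempty if [Omega] is, and bounded if the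
   operator is bounded, in which case [sup] is their least upper bound. *)
Definition ber (A : H -> H) : R :=
  sup [set complex.Re `|inner (A (nkernel p.1)) (nkernel p.2)| | p in [set: Omega * Omega]].

(* The orthogonal sum of H with itself is carried by [H * H].  Its library norm
   is the maximum of the norms of the components: it has the same topology, so
   the same bounded operators, as the Hilbert norm, but it is not the latter.  *)
Definition inner2 (x y : H * H) : R[i] := inner x.1 y.1 + inner x.2 y.2.

Definition kernel2 (l : Omega * Omega) : H * H := (kernel l.1, kernel l.2).

Definition nkernel2 (l : Omega * Omega) : H * H :=
  (sqrtC (`|kernel l.1| ^+ 2 + `|kernel l.2| ^+ 2))^-1 *: kernel2 l.

(* The adjoint of a bounded operator exists and is unique. *)
Definition adjoint2 (T : H * H -> H * H) : H * H -> H * H :=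
  xget (fun=> 0) [set S | forall x y, inner2 (T x) y = inner2 x (S y)].

Definition tber (t : R) (T : H * H -> H * H) : R :=
  sup [set t * complex.Re `|inner2 (T (nkernel2 p.1)) (nkernel2 p.2)| +
           (1 - t) * complex.Re `|inner2 (adjoint2 T (nkernel2 p.1)) (nkernel2 p.2)|
      | p in [set: (Omega * Omega) * (Omega * Omega)]].

(* The operator matrix [[A, B], [C, D]] acting on column vectors. *)
Definition block_op (A B C D : H -> H) (x : H * H) : H * H :=
  (A x.1 + B x.2, C x.1 + D x.2).

End Berezin.

(* Main.v *)
Require Import Defs.
From mathcomp Require Import all_boot all_order all_algebra complex.
From mathcomp Require Import reals topology normedtype.
From mathcomp Require Import sesquilinear boolp classical_sets ring lra.
Import Order.TTheory GRing.Theory Num.Theory.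
Import numFieldNormedType.Exports.
Local Open Scope ring_scope.

(** Write the normalized kernel of H (+) H at (l1, l2) as (a k^_l1, b k^_l2),
    where a, b >= 0 and a^2 + b^2 <= 1 ([nkernel2_coord]), and similarly
    (c k^_m1, d k^_m2) at (m1, m2).  Let T be the off-diagonal operator with
    entries A and B.  Then
      <T k^_l, k^_m> = b c <A k^_l2, k^_m1> + a d <B k^_l1, k^_m2>,
    so its modulus is at most b c ber A + a d ber B ([inner2_offdiag_le]).
    As <T* k^_l, k^_m> is the conjugate of <T k^_m, k^_l>, the same bound with
    the roles of l and m exchanged, that is a d ber A + b c ber B, holds for
    the adjoint.  With p = b c and q = a d, the weighted sum of both is
      (t p + (1 - t) q) ber A + (t q + (1 - t) p) ber B,
    where p + q <= 1 because 2 (b c + a d) <= a^2 + b^2 + c^2 + d^2 <= 2, so that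
    both coefficients are at most max(t, 1 - t) ([convex_weights_le]).

    Since [ber] is a supremum in R, it bounds the quantities above only if they
    are bounded: this is where the continuity of A and B is used, through the
    Cauchy-Schwarz inequality ([ber_upper_bound]). *)

Section RealPart.
Context {R : realType}.
Implicit Types x y : R[i].

Lemma Re_le x y : x <= y -> complex.Re x <= complex.Re y.
Proof. by rewrite lecE => /andP[]. Qed.

Lemma Re_norm_ge0 x : 0 <= complex.Re `|x|.
Proof. exact: (Re_le _ _ (normr_ge0 x)). Qed.

Lemma Re_normM x y :
  complex.Re `|x * y| = complex.Re `|x| * complex.Re `|y|.
Proof. exact: ComplexField.Normc.normcM. Qed.

Lemma Re_normD x y :
  complex.Re `|x + y| <= complex.Re `|x| + complex.Re `|y|.
Proof. by have := Re_le _ _ (ler_normD x y); rewrite raddfD. Qed.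

Lemma Re_norm_real (a : R) : 0 <= a -> complex.Re `|a%:C%C| = a.
Proof. by move=> a0; rewrite ger0_norm // ler0c. Qed.

End RealPart.

Section HilbertSpace.
Context {R : realType} {H : hilbertType R}.
Implicit Types x y : H.

Lemma innerC x y : inner x y = (inner y x)^*.
Proof. by rewrite (hermC (@inner R H)) /= expr0 mul1r. Qed.

Lemma innerDl x y z : inner (x + y) z = inner x z + inner y z.
Proof. exact: (linearDl (@inner R H)). Qed.

Lemma innerZl (a : R[i]) x y : inner (a *: x) y = a * inner x y.
Proof. exact: (linearZl_LR (@inner R H)). Qed.

Lemma innerZr (a : R[i]) x y : inner x (a *: y) = a^* * inner x y.
Proof. by rewrite innerC innerZl rmorphM /= -innerC. Qed.

Lemma innerDr x y z : inner z (x + y) = inner z x + inner z y.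
Proof. by rewrite innerC innerDl rmorphD /= -!innerC. Qed.

(** Unlike [CauchySchwarz], this holds without any restriction on the
    dimension. *)
Lemma inner_CauchySchwarz x y : `|inner x y| <= `|x| * `|y|.
Proof.
have [->|y0] := eqVneq y 0.
  by rewrite -(scale0r (0 : H)) innerZr conjC0 mul0r normr0 mulr_ge0.
have ny : 0 < `|y| ^+ 2 by rewrite exprn_gt0 // normr_gt0.
rewrite -(ler_pXn2r (ltn0Sn 1)) ?nnegrE ?mulr_ge0 // exprMn.
(* The squared norm of the following vector is
   `|y|^2 (`|x|^2 `|y|^2 - `|<x, y>|^2). *)
pose z := (`|y| ^+ 2) *: x - inner x y *: y.
have : 0 <= `|z| ^+ 2 by rewrite exprn_ge0.
rewrite -innerE /z -scaleNr innerDl !innerDr !innerZl !innerZr !innerE.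
rewrite (innerC y x) rmorphN rmorphXn /= (conj_Creal (normr_real y)) normCK => h.
rewrite -subr_ge0 -(pmulr_rge0 _ ny).
apply: le_trans h _; rewrite le_eqVlt; apply/orP; left; apply/eqP; ring.
Qed.

Lemma linear_continuous_bound (A : {linear H -> H}) : continuous A ->
  exists M : R[i], forall x, `|A x| <= M * `|x|.
Proof.
move=> /linear_bounded_continuous /linear_boundedP [M [Mreal hM]].
by exists (M + 1); apply: hM; rewrite ltrDl.
Qed.

End HilbertSpace.

Section BerezinNumbers.
Context {R : realType} {Omega : Type} {H : functionalHilbertType R Omega}.
Implicit Types (l m : Omega * Omega) (A B : {linear H -> H}).

(** Also true if the kernel vanishes, [nkernel l] being then 0; likewise for the
    lemmas on [nkernel] and [nkernel2] that follow. *)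
Lemma nkernelK (l : Omega) : `|kernel l : H| *: nkernel l = kernel l :> H.
Proof.
rewrite /nkernel scalerA; have [->|k0] := eqVneq (kernel l : H) 0.
  by rewrite scaler0.
by rewrite divff ?normr_eq0 // scale1r.
Qed.

Lemma norm_nkernel_le1 (l : Omega) : `|nkernel l : H| <= 1.
Proof.
rewrite /nkernel normrZ normfV normr_id.
have [->|k0] := eqVneq (kernel l : H) 0; first by rewrite normr0 mulr0 ler01.
by rewrite mulVf ?normr_eq0.
Qed.

Lemma ber_upper_bound A : continuous A -> forall l m : Omega,
  complex.Re `|inner (A (nkernel l)) (nkernel m)| <= ber A.
Proof.
move=> /linear_continuous_bound [M hM] l m.
apply: ub_le_sup; last by exists (l, m).
exists (complex.Re `|M|) => _ [[u v] _ <-]; apply: Re_le.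
apply: le_trans (inner_CauchySchwarz _ _) _.
apply: le_trans (ler_pM _ _ (hM _) (norm_nkernel_le1 v)) _ => //.
rewrite mulr1; apply: le_trans (real_ler_norm _) _.
  by rewrite (ger0_real (le_trans _ (hM _))).
by rewrite normrM normr_id ler_piMr // norm_nkernel_le1.
Qed.

Lemma ber_ge0 A : inhabited Omega -> continuous A -> 0 <= ber A.
Proof.
move=> [l] cA; exact: le_trans (Re_norm_ge0 _) (ber_upper_bound A cA l l).
Qed.

(** The coordinates are [`|k_l.1| / s] and [`|k_l.2| / s] with
    [s = sqrtC (`|k_l.1| ^+ 2 + `|k_l.2| ^+ 2)].  The sum of their squares is 1,
    except that it is 0 if both kernels vanish. *)
Lemma nkernel2_coord l : exists a b : R,
  [/\ 0 <= a, 0 <= b, a ^+ 2 + b ^+ 2 <= 1 &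
    nkernel2 l = (a%:C%C *: nkernel l.1, b%:C%C *: nkernel l.2) :> H * H].
Proof.
set k1 : H := kernel l.1; set k2 : H := kernel l.2.
pose s : R[i] := sqrtC (`|k1| ^+ 2 + `|k2| ^+ 2).
have s0 : 0 <= s by rewrite sqrtC_ge0 addr_ge0 ?exprn_ge0.
have ReK z : 0 <= z -> (complex.Re (s^-1 * z))%:C%C = s^-1 * z.
  by move=> z0; rewrite RRe_real // ger0_real // mulr_ge0 ?invr_ge0.
exists (complex.Re (s^-1 * `|k1|)), (complex.Re (s^-1 * `|k2|)); split.
- by rewrite -ler0c ReK // mulr_ge0 ?invr_ge0.
- by rewrite -ler0c ReK // mulr_ge0 ?invr_ge0.
- rewrite -lecR rmorphD !rmorphXn /= !ReK // !exprMn -mulrDr exprVn.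
  have -> : `|k1| ^+ 2 + `|k2| ^+ 2 = s ^+ 2 by rewrite sqrtCK.
  have [->|sn0] := eqVneq (s ^+ 2) 0; first by rewrite mulr0 ler01.
  by rewrite mulVf.
- by rewrite !ReK // -!scalerA !nkernelK.
Qed.

Lemma inner2_offdiag_le A B (a b c d : R) l m :
  continuous A -> continuous B -> 0 <= a -> 0 <= b -> 0 <= c -> 0 <= d ->
  nkernel2 l = (a%:C%C *: nkernel l.1, b%:C%C *: nkernel l.2) :> H * H ->
  nkernel2 m = (c%:C%C *: nkernel m.1, d%:C%C *: nkernel m.2) :> H * H ->
  complex.Re `|inner2 (block_op (fun=> 0) A B (fun=> 0) (nkernel2 l))
                      (nkernel2 m)|
    <= b * c * ber A + a * d * ber B.
Proof.
move=> cA cB a0 b0 c0 d0 -> ->.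
have -> : inner2 (block_op (fun=> 0) A B (fun=> 0)
      (a%:C%C *: nkernel l.1, b%:C%C *: nkernel l.2))
      (c%:C%C *: nkernel m.1, d%:C%C *: nkernel m.2) =
    b%:C%C * (c%:C%C)^* * inner (A (nkernel l.2)) (nkernel m.1) +
    a%:C%C * (d%:C%C)^* * inner (B (nkernel l.1)) (nkernel m.2).
  rewrite /inner2 /block_op /= add0r addr0 (linearZ_LR A) (linearZ_LR B).
  by rewrite !innerZl !innerZr !mulrA.
apply: le_trans (Re_normD _ _) _.
rewrite !Re_normM !Re_norm_real // !norm_conjC !Re_norm_real //.
by apply: lerD; apply: ler_wpM2l; rewrite ?mulr_ge0 ?ber_upper_bound.
Qed.

Lemma inner2C (x y : H * H) : inner2 x y = (inner2 y x)^*.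
Proof. by rewrite /inner2 rmorphD /= -!innerC. Qed.

(** An equality if T has an adjoint; otherwise [adjoint2 T] is the zero map.
    Hence the existence of adjoints is never needed. *)
Lemma norm_adjoint2_le (T : H * H -> H * H) (x y : H * H) :
  complex.Re `|inner2 (adjoint2 T x) y| <= complex.Re `|inner2 (T y) x|.
Proof.
rewrite /adjoint2; case: xgetP => [S _ hS|_].
  by rewrite inner2C norm_conjC -hS.
rewrite (_ : inner2 _ _ = 0) ?normr0 ?Re_norm_ge0 //.
by rewrite /inner2 /= -(scale0r (0 : H)) !innerZl !mul0r addr0.
Qed.

End BerezinNumbers.

Lemma convex_weights_le (R : realFieldType) (t p q x y : R) :
  0 <= t <= 1 -> 0 <= p -> 0 <= q -> p + q <= 1 -> 0 <= x -> 0 <= y ->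
  t * (p * x + q * y) + (1 - t) * (q * x + p * y)
    <= Num.max t (1 - t) * (x + y).
Proof.
move=> /andP[t0 t1] p0 q0 pq x0 y0; set M := Num.max t (1 - t).
have tM : t <= M by rewrite le_max lexx.
have uM : 1 - t <= M by rewrite le_max lexx orbT.
have M0 : 0 <= M := le_trans t0 tM.
have aM : t * p + (1 - t) * q <= M by nra.
have bM : t * q + (1 - t) * p <= M by nra.
have -> : t * (p * x + q * y) + (1 - t) * (q * x + p * y)
  = (t * p + (1 - t) * q) * x + (t * q + (1 - t) * p) * y by ring.
by rewrite mulrDr; apply: lerD; apply: ler_wpM2r.
Qed.

Theorem corollary2p10 (R : realType) (Omega : Type)
  (H : functionalHilbertType R Omega) (t : R) (A B : {linear H -> H}) :
  inhabited Omega ->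
  (forall l : Omega, kernel l != 0 :> H) ->
  0 <= t <= 1 ->
  continuous A -> continuous B ->
  tber t (block_op (fun=> 0) A B (fun=> 0)) <= Num.max t (1 - t) * (ber A + ber B).
Proof.
move=> inh _ t01 cA cB; have /andP[t0 t1] := t01.
apply: ge_sup; first by have [o] := inh; eexists; exists ((o, o), (o, o)).
move=> _ [[l m] _ <-] /=.
have [a [b [a0 b0 ab El]]] := nkernel2_coord (H := H) l.
have [c [d [c0 d0 cd Em]]] := nkernel2_coord (H := H) m.
apply: (@le_trans _ _ (t * (b * c * ber A + a * d * ber B) +
                       (1 - t) * (a * d * ber A + b * c * ber B))).
  apply: lerD; apply: ler_wpM2l; rewrite ?subr_ge0 //.
    exact: inner2_offdiag_le.
  apply: le_trans (norm_adjoint2_le _ _ _) _.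
  (* The coefficients of the bound for l and m exchanged. *)
  rewrite [a * d]mulrC [b * c]mulrC.
  exact: inner2_offdiag_le.
(* From 2 b c <= b^2 + c^2 and 2 a d <= a^2 + d^2. *)
have weights_le1 : b * c + a * d <= 1.
  have := sqr_ge0 (b - c); have := sqr_ge0 (a - d); nra.
by apply: convex_weights_le; rewrite ?mulr_ge0 ?ber_ge0.
Qed.
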